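(* Let $(L_k)_{k\ge1}$ be a sequence of positive integers, and let $\mathbf{a}=(B_1,B_2,B_3,\dots)$ be the concatenation of blocks, where the block $B_k$ consists of exactly $L_k$ consecutive entries, all equal to $k$. Suppose that for some $\varepsilon>0$, $r>0$ and $k_0$ we have $$\frac{L_k}{L_1+L_2+\dots+L_{k'}}\ge (2+\varepsilon)\ln k,\qquad \frac{L_k}{L_{k'+1}+L_{k'+2}+\dots+L_{k-1}}\ge 2r,\qquad L_k\ge k^4,$$ whenever $k,k'$ are integers with $k-k'\ge \frac{k}{\ln k}-2$ and $k,k'\ge k_0$. Then the $\mathbf{a}$-walk is almost surely recurrent.
   Context: Let $X_1,X_2,\dots$ be i.i.d. with $P(X_i=1)=P(X_i=-1)=\frac12$. For a non-random sequence $\mathbf{a}=(a_1,a_2,\dots)$ of positive numbers, the $\mathbf{a}$-walk is $S(n)=\sum_{k=1}^n a_kX_k$, $S(0)=0$. The walk is recurrent if $S(n)=0$ for infinitely many $n$. Conventions: $k_0\ge2$ is an integer (so that $\ln k>0$), and a ratio whose denominator is an empty sum is read as $+\infty$. *)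

(* Defs.v *)
From mathcomp Require Import all_boot all_order all_algebra.
From mathcomp Require Import finmap.
From mathcomp Require Import all_classical all_reals all_analysis.
Import Order.TTheory GRing.Theory Num.Theory.

Set Implicit Arguments.
Unset Strict Implicit.
Unset Printing Implicit Defensive.

Local Open Scope classical_set_scope.
Local Open Scope ring_scope.

(* Sequences of steps are indexed from 0: [X i] and [a i] stand for
   $X_{i+1}$ and $a_{i+1}$. *)

Definition mutually_independent (d : measure_display) (T : measurableType d)
    (R : realType) (P : probability T R) (X : nat -> {RV P >-> R}) : Prop :=
  forall (J : {fset nat}) (A : nat -> set R),
    (forall i, measurable (A i)) ->
    P (\bigcap_(i in [set` J]) (X i @^-1` A i)) =
    (\prod_(i <- J) P (X i @^-1` A i))%E.

Definition fair_sign (d : measure_display) (T : measurableType d)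
    (R : realType) (P : probability T R) (Y : {RV P >-> R}) : Prop :=
  P [set w | Y w = 1] = (2^-1)%:E /\ P [set w | Y w = -1] = (2^-1)%:E.

Definition walk (R : realType) (T : Type) (a : nat -> R) (X : nat -> T -> R)
    (n : nat) (w : T) : R :=
  \sum_(i < n) a i * X i w.

Definition as_recurrent (d : measure_display) (T : measurableType d)
    (R : realType) (P : probability T R) (S : nat -> T -> R) : Prop :=
  {ae P, forall w, infinite_set [set n | S n w = 0]}.

Definition blocks (L : nat -> nat) (m : nat) : seq nat :=
  flatten [seq nseq (L k) k | k <- iota 1 m].

(* If every [L k] with k >= 1 is positive, the first n.+1 blocks have more than
   n entries, so the default value of [nth] is never returned. [L 0] is not
   used. *)
Definition block_seq (L : nat -> nat) (n : nat) : nat :=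
  nth 0%N (blocks L n.+1) n.

Lemma blocks_cat (L : nat -> nat) (m p : nat) :
  blocks L (m + p) = blocks L m ++ flatten [seq nseq (L k) k | k <- iota m.+1 p].
Proof. by rewrite /blocks iotaD map_cat flatten_cat add1n. Qed.

Lemma size_blocks (L : nat -> nat) (m : nat) :
  size (blocks L m) = (\sum_(1 <= i < m.+1) L i)%N.
Proof.
rewrite /blocks size_flatten /shape -map_comp sumnE big_map /index_iota subn1 /=.
by apply: eq_bigr => i _; rewrite size_nseq.
Qed.

Lemma block_seqE (L : nat -> nat) (k j : nat) :
  (forall i, (1 <= i)%N -> (0 < L i)%N) -> (1 <= k)%N -> (j < L k)%N ->
  block_seq L (\sum_(1 <= i < k) L i + j) = k.
Proof.
move=> Lpos k1 jk; set n := (_ + _)%N.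
have km : (k <= n.+1)%N.
  rewrite /n -(prednK k1) ltnS (@leq_trans (\sum_(1 <= i < k) L i)) ?leq_addr//.
    rewrite -[leqLHS]muln1 -subn1 -sum_nat_const_nat !big_nat.
    by apply: leq_sum => i /andP[i1 _]; exact: Lpos.
  by rewrite prednK// leq_addr.
have -> : block_seq L n = nth 0%N (blocks L (k.-1 + (1 + (n.+1 - k)))) n.
  by rewrite /block_seq addnA addn1 prednK// subnKC.
rewrite blocks_cat nth_cat size_blocks prednK// /n ltnNge leq_addr/= addKn.
by rewrite nth_cat size_nseq jk nth_nseq jk.
Qed.

(* Main.v *)
Require Import Defs.
From mathcomp Require Import all_boot all_order all_algebra.
From mathcomp Require Import finmap.
From mathcomp Require Import all_classical all_reals all_analysis.
From mathcomp Require Import ring lra zify.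
Import Order.TTheory GRing.Theory Num.Theory.

Local Open Scope ring_scope.

(** Only odd block indices $k$ matter.  Let $x$ be the position of the walk when
block $k-1$ starts, and let $s$ be the integer square root of $L_k$.

- Taking $k' = k_0$ in the hypothesis gives
  $L_1 + \dots + L_{k-1} \le M L_k$ for some constant $M$ and all large $k$
  ([growth_bound]).  Hence the variance of $x$ is at most $k^2 M L_k$, and by
  Chebyshev's inequality $|x| \le B k s$ outside an event of probability at
  most $\delta$, where $B$ depends only on $M$ and $\delta$.

- Suppose $|x| \le B k s$.  In block $k-1$ the walk moves by $(k-1)Y$, where $Y$
  is a simple random walk with $L_{k-1} \ge (k-1)^4$ steps.  As $k$ is odd, the
  parity of $Y$ puts no constraint on $Y$ modulo $k$.  The central binomial
  probabilities are comparable to $L_{k-1}^{-1/2}$, so $x + (k-1)Y$ is divisible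
  by $k$ with probability at least $c/k$, with $|Y|$ of the order of
  $\sqrt{L_{k-1}}$ ([residue_prob]).  The walk then enters block $k$ at $kz$ with
  $|z|$ at most a constant times $\sqrt{L_k}$, and a simple random walk with
  $L_k$ steps crosses such a level with probability bounded below
  ([prob_reaches_zero]).  So block $k$ contains a zero of the walk with
  probability at least $c/k$, whatever happened before block $k-1$
  ([prob_reaches_zero_next_block]).

- Let $e_m$ be the probability that none of the blocks $2j+1$ with
  $I \le j < m$ contains a zero.  The two facts give
  $e_{m+1} \le e_m - \frac{c}{2m+1}(e_m - \delta)$ ([avoids_zero_step]).  The
  harmonic series diverges, so $e_m \le 2\delta$ for some $m$
  ([harmonic_descent]).  As $\delta$ is arbitrary, almost surely some block
  $2j+1$ with $j \ge I$ contains a zero, and this holds for every $I$.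

Everything but the last sentence concerns finitely many fair signs, so it is
proved for averages over sign sequences; [prob_signs] carries the result over to
the probability space. *)

(** * Averages over sign sequences *)

Section Mean.
Variable R : realType.
Implicit Types (f g : seq bool -> R).

(** The expectation under the uniform law on the $2^n$ sign sequences of length
[n].  Defined by recursion, it turns the conditioning on a prefix into an
iterated average ([mean_cat]). *)
Fixpoint mean (n : nat) f : R :=
  if n is m.+1 then
    (mean m (fun s => f (true :: s)) + mean m (fun s => f (false :: s))) / 2
  else f [::].

Lemma eq_mean n f g :
  (forall s, size s = n -> f s = g s) -> mean n f = mean n g.
Proof.
elim: n f g => [|n IH] f g fg /=; first exact: fg.
by congr ((_ + _) / 2); apply: IH => s sn; apply: fg; rewrite /= sn.
Qed.

Lemma ler_mean n f g :
  (forall s, size s = n -> f s <= g s) -> mean n f <= mean n g.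
Proof.
elim: n f g => [|n IH] f g fg /=; first exact: fg.
rewrite ler_pM2r ?invr_gt0 ?ltr0n// lerD//;
  by apply: IH => s sn; apply: fg; rewrite /= sn.
Qed.

Lemma meanD n f g : mean n (fun s => f s + g s) = mean n f + mean n g.
Proof. by elim: n f g => [//|n IH] f g /=; rewrite !IH; field. Qed.

Lemma meanZ n (c : R) f : mean n (fun s => c * f s) = c * mean n f.
Proof. by elim: n f => [//|n IH] f /=; rewrite !IH; field. Qed.

Lemma mean_cst n (c : R) : mean n (fun=> c) = c.
Proof. by elim: n => [//|n IH] /=; rewrite !IH; field. Qed.

Lemma mean_cat m n f :
  mean (m + n) f = mean m (fun s => mean n (fun t => f (s ++ t))).
Proof. by elim: m f => [//|m IH] f; rewrite addSn /= !IH. Qed.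

(** Pascal's rule: the number of plus signs has the binomial law. *)
Lemma mean_count n (F : nat -> R) :
  mean n (fun s => F (count id s)) =
  \sum_(j < n.+1) 'C(n, j)%:R / 2 ^+ n * F j.
Proof.
elim: n F => [|n IH] F /=; first by rewrite big_ord1 bin0 expr0; field.
rewrite (IH (fun j => F j.+1)) (IH (fun j => F (0 + j)%N)).
rewrite mulrDl !mulr_suml [RHS]big_ord_recl.
rewrite [X in _ = _ + X](_ : _ =
   \sum_(j < n.+1) ('C(n, j)%:R / 2 ^+ n * F j.+1) / 2
 + \sum_(j < n.+1) ('C(n, j.+1)%:R / 2 ^+ n * F j.+1) / 2).
  rewrite addrCA; congr (_ + _).
  rewrite [in RHS]big_ord_recr /= (bin_small (ltnSn n)) !mul0r addr0.
  rewrite [LHS]big_ord_recl; congr (_ + _).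
  by rewrite !bin0 exprS invfM /=; field; rewrite expf_neq0// pnatr_eq0.
rewrite -big_split; apply: eq_bigr => j _ /=.
rewrite /bump /= add1n binS natrD exprS.
by field; rewrite expf_neq0// pnatr_eq0.
Qed.

(** Flipping all the signs preserves the average; it reduces negative levels to
positive ones. *)
Lemma mean_negb n (f : seq bool -> R) :
  mean n (fun s => f (map negb s)) = mean n f.
Proof.
elim: n f => [//|n IH] f /=.
by rewrite (IH (fun s => f (false :: s))) (IH (fun s => f (true :: s))) addrC.
Qed.

End Mean.

Arguments mean {R}.

(** * Lower bounds for binomial probabilities *)

Lemma isqrt_exists n : exists s, (s ^ 2 <= n < s.+1 ^ 2)%N.
Proof.
elim: n => [|n [s /andP[sn ns]]]; first by exists 0%N.
have [e|ne] := eqVneq n.+1 (s.+1 ^ 2)%N; first by exists s.+1; nia.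
by exists s; nia.
Qed.

(** This is $\binom{2m}{m} \ge 4^m / (2 \sqrt m)$, squared.  In the induction the
ratio of consecutive sides is controlled by $(2m+1)^2 \ge 4m(m+1)$, written
below for $m+1$. *)
Lemma central_bin m : (0 < m)%N -> (16 ^ m <= 4 * m * 'C(m.*2, m) ^ 2)%N.
Proof.
case: m => // m _; elim: m => [//|m IH].
have e : (m.+2 * 'C(m.+2.*2, m.+2) = 2 * (m.*2 + 3) * 'C(m.+1.*2, m.+1))%N.
  have h1 : (m.+2 * 'C(m.+2.*2, m.+2) = m.+2.*2 * 'C(m.+1.*2.+1, m.+1))%N.
    by rewrite -mul_bin_diag doubleS.
  have h2 : (m.+2 * 'C(m.+1.*2.+1, m.+1) = m.+1.*2.+1 * 'C(m.+1.*2, m.+1))%N.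
    have := mul_bin_down m.+1.*2.+1 m.+1.
    by rewrite (_ : (m.+1.*2.+1 - m.+1 = m.+2)%N) /=; lia.
  nia.
rewrite -(@leq_pmul2l (m.+2 ^ 2)) ?expn_gt0//.
apply: (@leq_trans (4 * m.+2 * (m.+2 * 'C(m.+2.*2, m.+2)) ^ 2)); last nia.
rewrite e expnS; move: IH; set b := 'C(_, _); set p := (16 ^ _)%N => IH.
apply: (@leq_trans (m.+2 ^ 2 * (16 * (4 * m.+1 * b ^ 2)))).
  by rewrite !leq_mul2l IH !orbT.
have h : (m.+2 * (16 * m.+1) <= (2 * (m.*2 + 3)) ^ 2)%N by nia.
have := leq_mul (leqnn (4 * m.+2 * b ^ 2)) h.
apply: etrans; congr (_ <= _)%N; [ring|].
by rewrite -muln2; ring.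
Qed.

Section BinomialBounds.
Variable R : realType.

(** Consecutive binomials have ratio
$\frac{m-j}{m+j+1} = 1 - \frac{2j+1}{m+j+1} \ge 1 - \frac{2J}{m}$ when
$j < J$. *)
Lemma bin_ratio m J j : (0 < m)%N -> (4 * J <= m)%N -> (j <= J)%N ->
  ('C(m.*2, m)%:R : R) * (1 - 2 * J%:R / m%:R) ^+ j <= 'C(m.*2, m + j)%:R.
Proof.
move=> m0 Jm; have m0R : 0 < m%:R :> R by rewrite ltr0n.
elim: j => [|j IH] jJ; first by rewrite expr0 mulr1 addn0.
rewrite exprSr mulrA.
have JmR : 4 * J%:R <= m%:R :> R by rewrite -natrM ler_nat.
have q0 : 0 <= 1 - 2 * J%:R / m%:R :> R.
  by rewrite subr_ge0 ler_pdivrMr// mul1r; have := ler0n R J; lra.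
apply: le_trans (ler_wpM2r q0 (IH (ltnW jJ))) _.
have := congr1 (fun n => n%:R : R) (mul_bin_left m.*2 (m + j)).
rewrite !natrM (_ : (m.*2 - (m + j) = m - j)%N); last lia.
rewrite natrB; last lia.
set b := _%:R; set b' := _%:R => e.
rewrite -(ler_pM2l (_ : 0 < (m + j).+1%:R :> R)) ?ltr0n// addnS e.
rewrite mulrCA mulrC ler_wpM2r ?ler0n//.
rewrite mulrBr mulr1 -addn1 !natrD.
have jJR : j%:R + 1 <= J%:R :> R by rewrite natr1 ler_nat.
have h : 2 * J%:R <= (m%:R + j%:R + 1) * (2 * J%:R / m%:R) :> R.
  rewrite mulrA ler_pdivlMr// mulrC ler_wpM2r ?mulr_ge0//.
  by have := ler0n R j; lra.
lra.
Qed.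

(** With $J \le Bs$ and $s^2 \le 2m+1 \le 3m$, the loss
$(1 - 2J/m)^J \ge e^{-4J^2/m} \ge e^{-12B^2}$ with respect to the central
binomial is a constant. *)
Lemma bin_half_lb (B : nat) : exists c : R, 0 < c /\
  forall m s J j : nat, (16 * B.+1 < s)%N -> (s ^ 2 <= m.*2.+1)%N ->
   (m.*2 < s.+1 ^ 2)%N -> (J <= B * s)%N -> (j = m + J \/ j = m - J)%N ->
   c / s%:R <= 'C(m.*2, j)%:R / 4 ^+ m.
Proof.
exists (expR (- (12 * B%:R ^+ 2)) / 4); split.
  by rewrite divr_gt0 ?expR_gt0 ?ltr0n.
move=> m s J j Bs sm ms JB jE.
have m0 : (0 < m)%N by nia.
have m0R : 0 < m%:R :> R by rewrite ltr0n.
have s0 : 0 < s%:R :> R by rewrite ltr0n; lia.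
have J4 : (4 * J <= m)%N by nia.
have -> : 'C(m.*2, j) = 'C(m.*2, m + J).
  case: jE => -> //; rewrite -[LHS]bin_sub; last lia.
  by congr 'C(_, _); lia.
rewrite ler_pdivlMr ?exprn_gt0//.
apply: le_trans (bin_ratio m J J m0 J4 (leqnn _)).
set q := 1 - _.
have x0 : 0 <= J%:R / m%:R :> R by rewrite divr_ge0.
have x1 : J%:R / m%:R <= 1/4 :> R.
  rewrite ler_pdivrMr//.
  have : (4 * J)%:R <= m%:R :> R by rewrite ler_nat.
  by rewrite natrM; lra.
have q0 : 0 < q by rewrite /q -mulrA; lra.
have q_ge : expR (- (4 * (J%:R / m%:R))) <= q.
  rewrite expRN -[leRHS]invrK lef_pV2 ?posrE ?expR_gt0 ?invr_gt0//.
  apply: le_trans (_ : 1 + 4 * (J%:R / m%:R) <= _); last exact: expR_ge1Dx.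
  rewrite -[leLHS]div1r ler_pdivrMr// /q -mulrA; nra.
have qJ : expR (- (12 * B%:R ^+ 2)) <= q ^+ J.
  apply: le_trans (_ : expR (- (4 * (J%:R / m%:R))) ^+ J <= _); last first.
    by rewrite lerXn2r// ?nnegrE ?expR_ge0// (le_trans (expR_ge0 _) q_ge).
  rewrite -expRM_natl ler_expR mulrN lerN2.
  have -> : J%:R * (4 * (J%:R / m%:R)) = 4 * J%:R ^+ 2 / m%:R :> R.
    by field; rewrite gt_eqF.
  rewrite ler_pdivrMr//.
  by rewrite -!natrX -!natrM ler_nat; nia.
have cb : 4 ^+ m / (4 * s%:R) <= 'C(m.*2, m)%:R :> R.
  rewrite ler_pdivrMr ?mulr_gt0//.
  rewrite -(@ler_pXn2r _ 2)// ?nnegrE ?mulr_ge0 ?exprn_ge0//.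
  rewrite -exprM mulnC exprM -natrX -natrX.
  have h := central_bin m m0.
  have : (16 ^ m <= ('C(m.*2, m) * (4 * s)) ^ 2)%N.
    by apply: leq_trans h _; rewrite expnMn mulnC leq_mul2l; apply/orP; right; nia.
  by rewrite -(ler_nat R) !natrX !natrM.
have -> : expR (- (12 * B%:R ^+ 2)) / 4 / s%:R * 4 ^+ m =
  4 ^+ m / (4 * s%:R) * expR (- (12 * B%:R ^+ 2)) :> R.
  by field; rewrite gt_eqF.
by rewrite ler_pM// ?expR_ge0// divr_ge0 ?exprn_ge0 ?mulr_ge0.
Qed.

(** The local form of the central limit theorem, as a one-sided bound with an
unspecified constant.  An odd $n$ is reduced to $n-1$, by Pascal's rule, at the
cost of a factor $2$. *)
Lemma bin_lb (B : nat) : exists c : R, 0 < c /\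
  forall n s j : nat, (16 * B.+3 < s)%N -> (s ^ 2 <= n < s.+1 ^ 2)%N ->
   (n <= j.*2 + B * s)%N -> (j.*2 <= n + B * s)%N ->
   c / s%:R <= 'C(n, j)%:R / 2 ^+ n.
Proof.
have [c [c0 H]] := bin_half_lb B.+2.
exists (c / 4); split; first by rewrite divr_gt0.
move=> n s j Bs sn nj jn.
have s0 : 0 < s%:R :> R by rewrite ltr0n; lia.
have [m [b nE]] : exists m (b : bool), n = (b + m.*2)%N.
  by exists n./2, (odd n); rewrite odd_double_half.
have mlb : c / s%:R <= 'C(m.*2, j)%:R / 4 ^+ m.
  apply: (H m s (if (m <= j)%N then j - m else m - j)%N) => //;
    by case: (leqP m j) => ?; lia.
apply: le_trans (_ : c / s%:R / 2 <= _).
  by rewrite mulrAC; have := divr_gt0 c0 s0; lra.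
rewrite ler_pdivrMr//; apply: le_trans mlb _.
rewrite nE exprD -mul2n exprM (_ : 2 ^+ 2 = 4 :> R); last by ring.
rewrite invfM mulrA mulrAC ler_wpM2r ?invr_ge0 ?exprn_ge0//.
case: b {nE}; last by rewrite expr0 add0n; have := ler0n R 'C(2 * m, j); lra.
rewrite add1n expr1 mulfVK// ler_nat.
by case: j {nj jn} => [|j]; rewrite ?bin0// binS leq_addr.
Qed.
End BinomialBounds.

(** * Simple random walks: tails, residues and crossings *)

Definition sign (b : bool) : int := if b then 1 else -1.
Definition sign_sum (s : seq bool) : int := \sum_(b <- s) sign b.

Lemma sign_sum_cons b s : sign_sum (b :: s) = sign b + sign_sum s.
Proof. by rewrite /sign_sum big_cons. Qed.

Lemma sign_sumE s : sign_sum s = (count id s).*2%:Z - (size s)%:Z.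
Proof.
elim: s => [|[] s IH]; first by rewrite /sign_sum big_nil.
  by rewrite sign_sum_cons IH /=; lia.
by rewrite sign_sum_cons IH /=; lia.
Qed.

Lemma sign_sum_negb s : sign_sum (map negb s) = - sign_sum s.
Proof.
elim: s => [|[] s IH]; first by rewrite /sign_sum big_nil.
  by rewrite /= !sign_sum_cons IH /=; lia.
by rewrite /= !sign_sum_cons IH /=; lia.
Qed.

Definition reaches_zero (y k : int) (u : seq bool) : bool :=
  has (fun i => y + k * sign_sum (take i u) == 0) (iota 0 (size u).+1).

(** A nearest-neighbour path that goes from $z \ge 0$ to a nonpositive integer
passes through $0$. *)
Lemma reaches_zero_down (k : int) (z : nat) u :
  sign_sum u <= - z%:Z -> reaches_zero (k * z%:Z) k u.
Proof.
move=> uz; suff [i iu zi] : exists2 i, (i <= size u)%N & z%:Z + sign_sum (take i u) = 0.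
  by apply/hasP; exists i; rewrite ?mem_iota// -mulrDr zi mulr0.
elim: u z uz => [|b u IH] z uz.
  by exists 0%N => //; move: uz; rewrite /sign_sum !big_nil; lia.
case: z uz => [|z] uz; first by exists 0%N => //; rewrite take0 /sign_sum big_nil.
have [z' z'E] : exists z' : nat, z'%:Z = z.+1%:Z + sign b.
  by case: b {uz} => /=; [exists z.+2|exists z]; lia.
have [|i iu zi] := IH z'; first by move: uz; rewrite sign_sum_cons; lia.
by exists i.+1 => //=; rewrite sign_sum_cons addrA -z'E.
Qed.

Lemma reaches_zero_negb (y k : int) u :
  reaches_zero y k (map negb u) = reaches_zero (- y) k u.
Proof.
rewrite /reaches_zero size_map; apply: eq_has => i /=.
by rewrite -map_take sign_sum_negb mulrN -oppr_eq0 opprD opprK.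
Qed.

(** Cut the interval into [q] disjoint windows of length [k]; each contains an
element satisfying [Q]. *)
Lemma sum_pred_ge (Q : pred nat) (k q a s : nat) :
  (forall b, exists2 j, (b <= j < b + k)%N & Q j) -> (q * k <= s)%N ->
  (q <= \sum_(a <= j < a + s) Q j)%N.
Proof.
move=> Qk; elim: q a s => [//|q IH] a s qs.
have [j /andP[aj jk] Qj] := Qk a.
rewrite (@big_cat_nat _ _ _ (a + k)) ?leq_addr ?leq_add2l//=; last by nia.
rewrite -add1n leq_add//.
  rewrite (@big_cat_nat _ _ _ j)//=; last lia.
  by rewrite [X in (_ + X)%N]big_ltn// Qj; lia.
rewrite (_ : (a + s = a + k + (s - k))%N); last by nia.
by apply: IH; rewrite mulSn in qs; lia.
Qed.

(** With [j] plus signs among [N], the walk moves by $2j - N$.  As $k$ is odd, $2$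
is invertible modulo $k$ with inverse $(k+1)/2$, so the congruence is solved by
one residue class of [j], that of $(x+N)(k+1)/2$. *)
Lemma residue_exists (k N : nat) (x : int) : odd k ->
  forall a, exists2 j, (a <= j < a + k)%N &
    (k %| x + (k%:Z - 1) * (j.*2%:Z - N%:Z))%Z.
Proof.
move=> ok a; have k0 : (0 < k)%N by case: k ok.
pose j0 : int := (x + N%:Z) * (k.+1./2)%:Z.
have k2 : (k.+1./2)%:Z * 2 = k%:Z + 1.
  by have := odd_double_half k.+1; rewrite /= ok /=; lia.
have r0 : 0 <= modz (j0 - a%:Z) k by rewrite modz_ge0//; lia.
have rk : modz (j0 - a%:Z) k < k by rewrite ltz_pmod.
have e := divz_eq (j0 - a%:Z) k.
move: r0 rk e; set r := modz _ _; set q := divz _ _ => r0 rk e.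
exists (a + `|r|)%N; first lia.
have -> : (a + `|r|).*2%:Z = 2 * (j0 - q * k%:Z) by lia.
apply/dvdzP.
exists (2 * j0 - 2 * q * k%:Z - N%:Z - (x + N%:Z) + 2 * q).
have h : 2 * j0 = (x + N%:Z) * (k%:Z + 1) by rewrite /j0 -k2; ring.
by move: h; clear; nia.
Qed.

Section SimpleWalk.
Variable R : realType.

(** Since $s \approx \sqrt n$, the binomial law restricted to the window dominates
a constant times the uniform law on the window.  The tails and the residues of
the simple random walk are both read off from this. *)
Lemma mean_window (B : nat) : exists c : R, 0 < c /\
  forall (n s a : nat) (F : nat -> R), (forall j, 0 <= F j) ->
   (16 * B.+3 < s)%N -> (s ^ 2 <= n < s.+1 ^ 2)%N ->
   (n <= a.*2 + B * s)%N -> ((a + s).*2 <= n + B * s)%N ->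
   c / s%:R * (\sum_(a <= j < a + s) F j) <= mean n (fun t => F (count id t)).
Proof.
have [c [c0 H]] := bin_lb R B; exists c; split => //.
move=> n s a F F0 Bs sn na an.
have asn : (a + s <= n.+1)%N by nia.
rewrite mean_count -(big_mkord predT (fun j => 'C(n, j)%:R / 2 ^+ n * F j)).
have G0 (j : nat) : 0 <= 'C(n, j)%:R / 2 ^+ n * F j.
  by rewrite mulr_ge0// divr_ge0// exprn_ge0.
rewrite (@big_cat_nat _ _ _ a 0)/=; [|lia|lia].
rewrite (@big_cat_nat _ _ _ (a + s) a n.+1)/=; [|lia|lia].
rewrite addrCA ler_wpDr//; first by rewrite addr_ge0// sumr_ge0.
rewrite mulr_sumr ler_sum_nat// => j /andP[aj js].
by rewrite ler_wpM2r// H//; lia.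
Qed.

(** It is enough to count the [s] values of the number of plus signs that are just
above the level [z]: each has probability at least $c/s$. *)
Lemma sign_sum_tail (B : nat) : exists c : R, 0 < c /\
  forall n s z : nat, (16 * B.+3 < s)%N -> (s ^ 2 <= n < s.+1 ^ 2)%N ->
   (z + 4 * s <= B * s)%N ->
   c <= mean n (fun t => (z%:Z <= sign_sum t)%R%:R).
Proof.
have [c [c0 H]] := mean_window B; exists c; split => // n s z Bs sn zs.
(* The first number of plus signs for which the sum of the signs exceeds [z]. *)
pose a := ((n + z)./2).+1.
have [a1 a2] : (n + z <= a.*2)%N /\ (a.*2 <= n + z + 2)%N.
  by have := odd_double_half (n + z); rewrite /a; case: odd => /=; lia.
pose F j : R := (n + z <= j.*2)%N%:R.
rewrite (eq_mean _ _ _ (fun s => F (count id s))); last first.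
  by move=> t tn; rewrite sign_sumE tn /F; congr ((_ : bool)%:R); lia.
apply: le_trans (H n s a F _ _ _ _ _) => //; [|lia|nia].
rewrite big_nat (eq_bigr (fun=> 1)).
  rewrite -big_nat big_const_nat iter_addr_0 addKn -mulr_natr mul1r.
  by rewrite divfK// pnatr_eq0; lia.
by move=> j /andP[aj _]; rewrite /F (_ : (n + z <= j.*2)%N)//; lia.
Qed.

(** In a window of $s \ge (k-1)^2$ consecutive values of the number of plus signs,
at least $\lfloor s/k \rfloor \ge s/(2k)$ lie in the required residue class. *)
Lemma residue_prob : exists c : R, 0 < c /\
  forall (k N s : nat) (x : int), odd k -> (100 < k)%N ->
    (k.-1 ^ 4 <= N)%N -> (s ^ 2 <= N < s.+1 ^ 2)%N ->
  c / k%:R <= mean N (fun t =>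
    ((k %| x + (k%:Z - 1) * sign_sum t)%Z && (`|sign_sum t| <= 2 * s%:Z))%:R).
Proof.
have [c [c0 H]] := mean_window 2; exists (c / 2); split; first by rewrite divr_gt0.
move=> k N s x ok k100 kN sN.
have sk : (k.-1 ^ 2 <= s)%N.
  rewrite -ltnS -(@ltn_exp2r _ _ 2)// -expnM; lia.
have s0 : (0 < s)%N by nia.
have k0R : 0 < k%:R :> R by rewrite ltr0n; lia.
have s0R : 0 < s%:R :> R by rewrite ltr0n.
pose Q (j : nat) := (k %| x + (k%:Z - 1) * (j.*2%:Z - N%:Z))%Z.
pose F j : R := (Q j && (`|j.*2%:Z - N%:Z| <= 2 * s%:Z))%:R.
rewrite (eq_mean _ _ _ (fun s => F (count id s))); last first.
  by move=> t tn; rewrite sign_sumE tn.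
have a1 := odd_double_half N.
apply: le_trans (H N s N./2 F _ _ _ _ _) => //; [|nia|lia|lia].
have -> : \sum_(N./2 <= j < N./2 + s) F j =
    (\sum_(N./2 <= j < N./2 + s) Q j)%N%:R.
  rewrite natr_sum; apply: eq_big_nat => j /andP[aj js].
  by rewrite /F (_ : `|_| <= _) ?andbT//; lia.
apply: le_trans (_ : c / s%:R * (s %/ k)%:R <= _); last first.
  rewrite ler_wpM2l ?divr_ge0 ?(ltW c0) ?(ltW s0R)//.
  rewrite ler_nat; apply: (@sum_pred_ge Q k) => //.
    exact: residue_exists.
  exact: leq_divM.
rewrite ler_pdivrMr// [c / s%:R * _]mulrAC [leRHS]mulrAC ler_pdivlMr// -!mulrA.
rewrite ler_pM2l//.
rewrite ler_pdivrMl// -!natrM ler_nat.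
have := divn_eq s k; have : (s %% k < k)%N by rewrite ltn_pmod; lia.
have : (0 < s %/ k)%N by rewrite divn_gt0; nia.
by set q := (s %/ k)%N; set r := (s %% k)%N => *; nia.
Qed.

(** A path that starts at $kz$ with $z \ge 0$ reaches $0$ as soon as the sum of its
signs is at most $-z$, so the reflection principle can be dispensed with. *)
Lemma prob_reaches_zero (B : nat) : exists c : R, 0 < c /\
  forall (n s : nat) (k y z : int), (16 * (B + 4).+3 < s)%N ->
   (s ^ 2 <= n < s.+1 ^ 2)%N -> y = k * z -> `|z| <= (B * s)%:Z ->
   c <= mean n (fun u => (reaches_zero y k u)%:R).
Proof.
have [c [c0 H]] := sign_sum_tail (B + 4); exists c; split => // n s k y z Bs sn -> zs.
have cneg : c <= mean n (fun u => (reaches_zero (- (k * `|z|)) k u)%:R).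
  apply: le_trans (H n s `|z|%N Bs sn _) _; first by lia.
  apply: ler_mean => u _; rewrite ler_nat.
  case: leP => //= zu; rewrite lt0b -reaches_zero_negb -abszE reaches_zero_down//.
  by rewrite sign_sum_negb; lia.
have [z0|z0] := ltrP z 0.
  by move: cneg; rewrite ltr0_norm// mulrN opprK.
rewrite -mean_negb; under eq_mean => u _ do rewrite reaches_zero_negb.
by move: cneg; rewrite ger0_norm.
Qed.

(** The first average is over block $k-1$, where the steps are $\pm(k-1)$, and the
second one over block $k$.  The first block makes the position divisible by $k$
with probability of order $1/k$ and keeps it $O(k \sqrt n)$, since
$N \le M n$; the second one then reaches $0$ with probability bounded below. *)
Lemma prob_reaches_zero_next_block (M B : nat) : exists c : R, 0 < c /\ exists K : nat,
  forall (k N n s : nat) (x : int), odd k -> (K < k)%N ->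
    (k.-1 ^ 4 <= N)%N -> (k ^ 4 <= n)%N -> (N <= M * n)%N ->
    (s ^ 2 <= n < s.+1 ^ 2)%N -> `|x| <= (B * k * s)%:Z ->
  c / k%:R <= mean N (fun t =>
     mean n (fun u => (reaches_zero (x + (k%:Z - 1) * sign_sum t) k u)%:R)).
Proof.
have [c1 [c10 H1]] := residue_prob.
have [c2 [c20 H2]] := prob_reaches_zero (B + 4 * M).
exists (c2 * c1); split; first by rewrite mulr_gt0.
exists (100 + 16 * ((B + 4 * M) + 4).+3)%N.
move=> k N n s x ok Kk kN kn NM sn xB.
have sk : (k ^ 2 <= s)%N by rewrite -ltnS -(@ltn_exp2r _ _ 2)// -expnM; lia.
have kk2 : (k <= k ^ 2)%N by rewrite -[leqLHS]expn1 leq_pexp2l//; lia.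
have [s' sN] := isqrt_exists N.
have s's : (s' <= 2 * M * s)%N.
  rewrite -(@leq_exp2r _ _ 2)//; apply: (@leq_trans (M * n)); first lia.
  apply: (@leq_trans (M * (2 * s) ^ 2)); first by rewrite leq_mul2l; nia.
  by rewrite !expnMn; case: (M) => [|M']; [|nia].
rewrite -mulrA; apply: le_trans (ler_wpM2l (ltW c20) (H1 k N s' x ok _ kN sN)) _.
  by lia.
rewrite -meanZ; apply: ler_mean => t tN.
case: andP => [[/dvdzP[z zE] ts]|_] /=; last first.
  rewrite mulr0; apply: le_trans (_ : mean n (fun=> 0) <= _).
    by rewrite mean_cst.
  by apply: ler_mean => u _; rewrite ler0n.
rewrite mulr1; apply: (H2 n s k _ z); [lia|exact: sn|by rewrite zE mulrC|].
have k0 : (0 : int) < k by lia.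
rewrite -(ler_pM2l k0) -{1}(ger0_norm (ltW k0)) -normrM mulrC -zE.
apply: le_trans (ler_normD _ _) _; rewrite normrM (ger0_norm (_ : 0 <= k%:Z - 1)); last lia.
have : (k%:Z - 1) * `|sign_sum t| <= k%:Z * (4 * M * s)%:Z.
  by apply: ler_pM => //; lia.
by move: xB; rewrite !PoszM PoszD; lia.
Qed.

End SimpleWalk.

(** * The walk along the blocks *)

Definition position (a : nat -> nat) (s : seq bool) : int :=
  \sum_(i < size s) (a i)%:Z * sign (nth true s i).

Lemma position_cat a s t :
  position a (s ++ t) = position a s + position (fun i => a (size s + i)%N) t.
Proof.
rewrite /position size_cat big_split_ord /=; congr (_ + _); apply: eq_bigr => i _ /=.
  by rewrite nth_cat ltn_ord.
by rewrite nth_cat ltnNge leq_addr /= addKn.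
Qed.

Lemma position_cst a k t : (forall i, (i < size t)%N -> a i = k) ->
  position a t = k%:Z * sign_sum t.
Proof.
move=> ak; rewrite /position /sign_sum (big_nth true) big_mkord mulr_sumr.
by apply: eq_bigr => i _; rewrite ak.
Qed.

Definition block_start (L : nat -> nat) (k : nat) : nat := \sum_(1 <= i < k) L i.

Lemma block_startS L k : (0 < k)%N -> block_start L k.+1 = (block_start L k + L k)%N.
Proof. by move=> k0; rewrite /block_start big_nat_recr. Qed.

Lemma leq_block_start L : {homo block_start L : k l / (k <= l)%N}.
Proof.
move=> k l kl; case: k kl => [|k] kl; first by rewrite /block_start big_geq.
by rewrite /block_start [leqRHS](@big_cat_nat _ _ _ k.+1)//= leq_addr.
Qed.

Lemma leq_block_start_id (L : nat -> nat) :
  (forall k, (1 <= k)%N -> (0 < L k)%N) -> forall k, (k <= block_start L k.+1)%N.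
Proof.
by move=> Lpos; elim=> // k IH; rewrite block_startS//; have := Lpos k.+1 erefl; lia.
Qed.

Definition zero_in_block L (k : nat) (s : seq bool) : bool :=
  has (fun n => position (block_seq L) (take n s) == 0) (iota (block_start L k) (L k).+1).

Definition avoids_zero L (I m : nat) (s : seq bool) : bool :=
  all (fun j => ~~ zero_in_block L j.*2.+1 s) (index_iota I m).

Lemma zero_in_block_cat L k s t : (block_start L k + L k <= size s)%N ->
  zero_in_block L k (s ++ t) = zero_in_block L k s.
Proof.
move=> ks; apply: eq_in_has => n; rewrite mem_iota => /andP[_ nk].
by rewrite takel_cat//; lia.
Qed.

Lemma avoids_zero_cat L I m s t : (block_start L m.*2 <= size s)%N ->
  avoids_zero L I m (s ++ t) = avoids_zero L I m s.
Proof.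
move=> ms; apply: eq_in_all => j; rewrite mem_index_iota => /andP[_ jm].
rewrite zero_in_block_cat// -block_startS//; apply: leq_trans ms; apply: leq_block_start; lia.
Qed.

Section Blocks.
Variable L : nat -> nat.
Hypothesis Lpos : forall k, (1 <= k)%N -> (0 < L k)%N.
Let a := block_seq L.

Lemma position_block k s t : (1 <= k)%N -> size s = block_start L k ->
  (size t <= L k)%N -> position a (s ++ t) = position a s + k%:Z * sign_sum t.
Proof.
move=> k1 sk tk; rewrite position_cat (@position_cst _ k t)// => i it.
by rewrite sk /a /block_start block_seqE//; exact: leq_trans tk.
Qed.

Lemma zero_in_blockE k s u : (1 <= k)%N -> size s = block_start L k -> size u = L k ->
  zero_in_block L k (s ++ u) = reaches_zero (position a s) k u.
Proof.
move=> k1 sk uk; rewrite /zero_in_block /reaches_zero uk -[block_start L k]addn0 iotaDl has_map.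
apply: eq_in_has => i; rewrite mem_iota => /andP[_ ik] /=.
rewrite takeD take_size_cat// drop_size_cat// (@position_block k)//.
by rewrite size_take; case: ltnP; lia.
Qed.

Lemma block_seq_le k i : (i < block_start L k)%N -> (block_seq L i <= k)%N.
Proof.
elim: k => [|[|k] IH]; [by rewrite /block_start big_geq|by rewrite /block_start big_geq|].
have [ik _|ki] := ltnP i (block_start L k.+1); first exact: leq_trans (IH ik) _.
rewrite block_startS// => ik.
by rewrite -(subnKC ki) /block_start block_seqE//; rewrite -/(block_start _ _); lia.
Qed.

End Blocks.

Section Recursion.
Variable R : realType.

(** Independent centred steps: the variances add up. *)
Lemma mean_position_sqr a n :
  mean n (fun s => (position a s)%:~R ^+ 2) = \sum_(i < n) (a i)%:R ^+ 2 :> R.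
Proof.
elim: n => [|n IH]; first by rewrite /= /position !big_ord0 expr0n.
rewrite -addn1 mean_cat addn1 big_ord_recr /= -IH -(mean_cst R n ((a n)%:R ^+ 2)) -meanD.
apply: eq_mean => s sn /=; rewrite !position_cat /position /= !big_ord1 /= !addn0 sn.
by rewrite mulr1 mulrN1 !rmorphD /= rmorphN /=; field.
Qed.

Lemma chebyshev_position (a : nat -> nat) n A (t : nat) : (0 < t)%N ->
  (forall i, (i < n)%N -> (a i <= A)%N) ->
  mean n (fun s => (t%:Z < `|position a s|)%R%:R) <= (A ^ 2 * n)%:R / t%:R ^+ 2 :> R.
Proof.
move=> t0 aA; rewrite mulrC.
apply: le_trans (_ : t%:R ^- 2 * mean n (fun s => (position a s)%:~R ^+ 2) <= _).
  rewrite -meanZ; apply: ler_mean => s _.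
  have t2 : 0 < t%:R ^+ 2 :> R by rewrite exprn_gt0// ltr0n.
  case: ltP => ts /=; last by rewrite mulr_ge0 ?sqr_ge0// invr_ge0 ltW.
  rewrite ler_pdivlMl// mulr1 -[leRHS]real_normK ?num_real//.
  rewrite lerXn2r ?nnegrE// -intr_norm -[t%:R]/(t%:~R) ler_int ltW//.
rewrite mean_position_sqr ler_wpM2l// ?invr_ge0 ?exprn_ge0//.
rewrite natrM mulr_natr -[n in leRHS]card_ord -sumr_const ler_sum// => i _.
by rewrite -natrX ler_nat leq_exp2r// aA.
Qed.

(** The event that there is no zero so far is decided before block $2m$, and so is
the event [bad] that the position is too large.  Outside [bad], the next two
blocks produce a zero with conditional probability at least $c/(2m+1)$, hence
the decrease is at least $\frac{c}{2m+1}$ times $e_m - P(bad)$. *)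
Lemma avoids_zero_step (L : nat -> nat) (M K0 : nat) (delta : R) :
  (forall k, (1 <= k)%N -> (0 < L k)%N) -> 0 < delta ->
  (forall k, (K0 <= k)%N -> (k ^ 4 <= L k)%N /\ (block_start L k <= M * L k)%N) ->
  exists c : R, 0 < c /\ exists K : nat, forall I m, (I <= m)%N -> (K <= m)%N ->
    mean (block_start L m.+1.*2) (fun s => (avoids_zero L I m.+1 s)%:R) <=
    mean (block_start L m.*2) (fun s => (avoids_zero L I m s)%:R) -
    c / m.*2.+1%:R * (mean (block_start L m.*2) (fun s => (avoids_zero L I m s)%:R) - delta).
Proof.
move=> Lpos delta0 HM.
(* Chebyshev's bound will be $k^2 M L_k / (B k s)^2 \le 4M/B^2$. *)
pose B := (Num.truncn (4 * M%:R / delta)).+1.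
have Bd : 4 * M%:R / B%:R ^+ 2 <= delta.
  have B0 : 1 <= B%:R :> R by rewrite ler1n.
  rewrite ler_pdivrMr ?exprn_gt0 ?ltr0n// [leRHS]mulrC -ler_pdivrMr//.
  apply: le_trans (_ : _ <= B%:R) _; last by rewrite expr2 ler_peMl// ler0n.
  by rewrite ltW// /B truncnS_gt.
have [c [c0 [K HK]]] := prob_reaches_zero_next_block R M B.
exists c; split => //; exists (K0 + K + 1)%N => I m Im Km.
set k := m.*2.+1.
have [Lk4 LkM] := HM k ltac:(lia).
have [LN4 _] := HM m.*2 ltac:(lia).
have m20 : (0 < m.*2)%N by lia.
have k0R : 0 < k%:R :> R by rewrite ltr0n.
have NM : (L m.*2 <= M * L k)%N by apply: leq_trans LkM; rewrite block_startS// leq_addl.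
have [s0 sn] := isqrt_exists (L k).
have s00 : (0 < s0)%N.
  rewrite lt0n; apply/eqP => e; move: sn; rewrite e.
  by have : (0 < k ^ 4)%N; [rewrite expn_gt0|lia].
pose t0 := (B * k * s0)%N.
have t00 : (0 < t0)%N by rewrite /t0 !muln_gt0 s00.
pose bad (s : seq bool) : R := (t0%:Z < `|position (block_seq L) s|)%R%:R.
have bad_le : mean (block_start L m.*2) bad <= delta.
  apply: le_trans (@chebyshev_position _ _ k _ t00 _) _.
    by move=> i im; apply: (@leq_trans m.*2); [exact: block_seq_le|lia].
  apply: le_trans Bd.
  have s0R : 0 < s0%:R :> R by rewrite ltr0n.
  have BR : 0 < B%:R :> R by rewrite ltr0n.
  rewrite ler_pdivrMr ?exprn_gt0 ?ltr0n//.
  have -> : 4 * M%:R / B%:R ^+ 2 * t0%:R ^+ 2 = (4 * M * k ^ 2 * s0 ^ 2)%:R :> R.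
    by rewrite /t0 !natrM; field; rewrite gt_eqF.
  rewrite ler_nat; apply: (@leq_trans (k ^ 2 * (M * L k))).
    rewrite leq_mul2l; apply/orP; right; apply: leq_trans LkM.
    by rewrite block_startS// leq_addr.
  rewrite (_ : (4 * M * k ^ 2 * s0 ^ 2 = k ^ 2 * (M * (4 * s0 ^ 2)))%N); last ring.
  by rewrite !leq_mul2l; apply/orP; right; apply/orP; right; nia.
have -> : block_start L m.+1.*2 = (block_start L m.*2 + (L m.*2 + L k))%N.
  by rewrite doubleS !block_startS// addnA.
rewrite mean_cat.
set e := mean _ (fun s => (avoids_zero L I m s)%:R).
apply: le_trans
  (_ : e + (- (c / k%:R) * e + (c / k%:R) * mean (block_start L m.*2) bad) <= _);
  last first.
  rewrite mulrBr mulNr; have : c / k%:R * mean (block_start L m.*2) bad <= c / k%:R * delta.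
    by rewrite ler_wpM2l// divr_ge0// ltW.
  lra.
rewrite -!meanZ -!meanD; apply: ler_mean => s sm.
rewrite mean_cat.
(* Conditionally on the past [s], only the zeros in block [k] are random. *)
have -> : mean (L m.*2) (fun t => mean (L k) (fun u =>
    (avoids_zero L I m.+1 (s ++ (t ++ u)))%:R)) =
  (avoids_zero L I m s)%:R * (1 - mean (L m.*2) (fun t => mean (L k) (fun u =>
    (reaches_zero (position (block_seq L) s + (k%:Z - 1) * sign_sum t) k u)%:R))) :> R.
  rewrite mulrBr mulr1 -mulrN -[- mean _ _]mulN1r -meanZ -meanZ.
  rewrite -{1}(mean_cst R (L m.*2) (avoids_zero L I m s)%:R) -meanD.
  apply: eq_mean => t tm; rewrite -meanZ -meanZ.
  rewrite -{1}(mean_cst R (L k) (avoids_zero L I m s)%:R) -meanD.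
  apply: eq_mean => u uk.
  rewrite {1}/avoids_zero {1}/index_iota subSn// -addn1 iotaD all_cat /= subnKC// andbT.
  rewrite -/(index_iota I m) -/(avoids_zero L I m _) avoids_zero_cat ?sm//.
  rewrite catA zero_in_blockE ?size_cat ?sm ?tm ?block_startS//.
  rewrite (@position_block L Lpos m.*2)// ?sm ?tm//.
  rewrite (_ : (m.*2%:Z = k%:Z - 1)) -/k; last by rewrite /k; lia.
  by case: avoids_zero; case: reaches_zero => /=; ring.
set p := mean (L m.*2) _.
have p0 : 0 <= p.
  rewrite -(mean_cst R (L m.*2) 0); apply: ler_mean => t _.
  by rewrite -(mean_cst R (L k) 0); apply: ler_mean => u _; rewrite ler0n.
have ck0 : 0 < c / k%:R by rewrite divr_gt0.
have : bad s = 0 -> c / k%:R <= p.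
  rewrite /bad => /eqP; rewrite pnatr_eq0 eqb0 -leNgt => sB; apply: (HK k _ _ s0);
    [by rewrite /= odd_double|lia|exact: LN4|exact: Lk4|exact: NM|exact: sn|exact: sB].
rewrite /bad; case: avoids_zero; case: (_ < _) => /= [_|/(_ erefl) h]; lra.
Qed.

End Recursion.

(** * Divergence of the harmonic series and growth of the blocks *)

Section Growth.
Variable R : realType.

(** As long as $e > 2\delta$, each step decreases $e_m$ by at least
$c\delta/(2m+1)$, so $e_{2m} \le e_m - c\delta/5$; after enough doublings $e$
would be negative. *)
Lemma harmonic_descent (e : nat -> R) (c delta : R) (I : nat) :
  0 < c -> 0 < delta -> (0 < I)%N ->
  (forall m, (I <= m)%N -> e m.+1 <= e m - c / m.*2.+1%:R * (e m - delta)) ->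
  exists2 m, (I <= m)%N & e m <= 2 * delta.
Proof.
move=> c0 d0 I0 He; apply: contrapT => /forall2NP nex.
have big m : (I <= m)%N -> 2 * delta < e m.
  by move=> Im; case: (nex m) => // /negP; rewrite -ltNge.
have step m l : (I <= m)%N -> (l <= m)%N ->
    e (m + l)%N <= e m - l%:R * (c * delta / (5 * m)%:R).
  move=> Im; elim: l => [|l IH] lm; first by rewrite addn0 mul0r subr0.
  rewrite addnS; apply: le_trans (He _ _) _; first by lia.
  have := IH (ltnW lm); have := big (m + l)%N ltac:(lia).
  rewrite -[l.+1%:R]natr1 mulrDl mul1r.
  set x := e _ => x2 IHx.
  have : c * delta / (5 * m)%:R <= c / (m + l).*2.+1%:R * (x - delta).
    rewrite mulrAC; apply: ler_pM; [|exact: ltW| |lra].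
      by rewrite divr_ge0 ?ler0n ?ltW.
    by rewrite ler_pM2l// lef_pV2 ?posrE ?ltr0n ?ler_nat; lia.
  move: IHx; set p := c * delta / _; set q := c / _ * _ => IHx.
  lra.
(* The decrease guaranteed when the index doubles. *)
pose g := c * delta / 5.
have g0 : 0 < g by rewrite divr_gt0 ?mulr_gt0.
have dbl j : e (2 ^ j * I)%N <= e I - j%:R * g.
  elim: j => [|j IH]; first by rewrite mul0r subr0 mul1n.
  set m := (2 ^ j * I)%N in IH.
  have m0 : (0 < m)%N by rewrite muln_gt0 expn_gt0.
  have Im : (I <= m)%N by rewrite leq_pmull// expn_gt0.
  have -> : (2 ^ j.+1 * I)%N = (m + m)%N by rewrite expnS /m; lia.
  apply: le_trans (step m m Im (leqnn _)) _.
  have -> : m%:R * (c * delta / (5 * m)%:R) = g.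
    by rewrite /g natrM; field; rewrite pnatr_eq0; lia.
  by rewrite -[j.+1%:R]natr1 mulrDl mul1r; lra.
pose j := (Num.truncn (e I / g)).+1.
have : e I < j%:R * g by rewrite -ltr_pdivrMr// /j truncnS_gt.
have := dbl j; have := big (2 ^ j * I)%N _; rewrite leq_pmull ?expn_gt0// => /(_ isT).
lra.
Qed.

(** The choice $k' = k_0$ is admissible once $k \ge 2k_0$ and $\ln k \ge 2$, because
then $k/\ln k \le k/2 \le k - k_0$.  The blocks up to $k_0$ then contribute at most
$L_k$ to the sum, and the other ones at most $L_k / (2r)$. *)
Lemma growth_bound (L : nat -> nat) (eps r : R) (k0 : nat) :
  (forall k : nat, (1 <= k)%N -> (0 < L k)%N) ->
  0 < eps -> 0 < r -> (2 <= k0)%N ->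
  (forall k k' : nat, (k0 <= k)%N -> (k0 <= k')%N ->
      k%:R / ln (k%:R : R) - 2 <= (k%:R : R) - k'%:R ->
      [/\ (((2 + eps) * ln (k%:R : R))%:E <=
            (L k)%:R%:E / (\sum_(1 <= j < k'.+1) L j)%:R%:E)%E,
          ((2 * r)%:E <=
            (L k)%:R%:E / (\sum_(k'.+1 <= j < k) L j)%:R%:E)%E
        & (k ^ 4 <= L k)%N]) ->
  exists M K : nat, forall k, (K <= k)%N ->
    (k ^ 4 <= L k)%N /\ (block_start L k <= M * L k)%N.
Proof.
move=> Lpos eps0 r0 k02 HL.
(* From [q] on, $\ln k \ge 2$. *)
set q := (Num.truncn (expR 2 : R)).+1.
exists (Num.truncn (1 + (2 * r)^-1)).+1, (k0.*2 + q.+1)%N.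
move=> k Kk.
have k0R : 0 < k%:R :> R by rewrite ltr0n; lia.
have ln2 : 2 <= ln (k%:R : R).
  rewrite -[2]expRK ler_ln ?posrE ?expR_gt0//.
  apply: le_trans (ltW (truncnS_gt _)) _; rewrite -/q ler_nat.
  by move: Kk; clear; lia.
have [|||H1 H2 H3] := HL k k0; [lia|lia| |split=> //].
  have kk : k%:R / ln (k%:R : R) <= k%:R / 2.
    by rewrite ler_pM2l// lef_pV2 ?posrE//; lra.
  have : (2 * k0)%:R <= k%:R :> R by rewrite ler_nat; lia.
  by rewrite natrM; lra.
have sum_gt0 a b : (0 < a)%N -> (a < b)%N -> (0 < \sum_(a <= j < b) L j)%N.
  by move=> a0 ab; rewrite big_ltn// addn_gt0 Lpos.
have ratio (x : R) (s : nat) : (0 < s)%N ->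
    (x%:E <= (L k)%:R%:E / s%:R%:E)%E -> x * s%:R <= (L k)%:R.
  move=> s0; rewrite inver pnatr_eq0 -[_ == 0]negbK -lt0n s0 /= -EFinM lee_fin.
  by rewrite ler_pdivlMr ?ltr0n.
have h1 := ratio _ _ (sum_gt0 1 k0.+1 erefl ltac:(lia)) H1.
have h2 := ratio _ _ (sum_gt0 k0.+1 k erefl ltac:(lia)) H2.
rewrite /block_start (@big_cat_nat _ _ _ k0.+1)/=; [|lia|lia].
rewrite -(ler_nat R) natrM natrD.
move: h1 h2; set s1 := (\sum_(1 <= _ < _) _)%:R; set s2 := (\sum_(k0.+1 <= _ < _) _)%:R.
set l := (L k)%:R => h1 h2.
have l0 : 0 <= l by rewrite ler0n.
have s10 : 0 <= s1 by rewrite ler0n.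
have : s1 <= l by apply: le_trans h1; rewrite ler_peMl//; nra.
have : s2 <= (2 * r)^-1 * l by rewrite ler_pdivlMl ?mulr_gt0.
have : (1 + (2 * r)^-1) * l <= (Num.truncn (1 + (2 * r)^-1)).+1%:R * l.
  by rewrite ler_wpM2r// ltW// truncnS_gt.
by rewrite mulrDl mul1r; lra.
Qed.
End Growth.

(** * Fair independent signs on the probability space *)

Section Signs.
Context (d : measure_display) (T : measurableType d) (R : realType)
  (P : probability T R) (X : nat -> {RV P >-> R}).
Hypothesis Xindep : mutually_independent X.
Hypothesis Xsign : forall i : nat, fair_sign (X i).
Local Open Scope classical_set_scope.

(** A sign that differs from $1$ is read as $-1$, which is correct almost
surely. *)
Definition signs (n : nat) (w : T) : seq bool := mkseq (fun i => X i w == 1) n.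

Lemma measurable_sign i (b : bool) : measurable [set w | (X i w == 1) = b].
Proof.
have m1 : measurable (X i @^-1` [set 1]) by exact: measurable_funPTI.
case: b.
  rewrite (_ : [set w | _] = X i @^-1` [set 1])//.
  by apply/seteqP; split => w /= /eqP.
rewrite (_ : [set w | _] = ~` (X i @^-1` [set 1])); first exact: measurableC.
by apply/seteqP; split => w /= => [/negbT/eqP|/eqP/negbTE].
Qed.

Lemma measurable_signs n (Q : seq bool -> bool) : measurable [set w | Q (signs n w)].
Proof.
elim: n Q => [|n IH] Q.
  have [q|q] := boolP (Q [::]).
    rewrite (_ : [set w | _] = setT)//; by apply/seteqP; split.
  rewrite (_ : [set w | _] = set0)//; apply/seteqP; split => // w.
rewrite (_ : [set w | _] =
  ([set w | Q (rcons (signs n w) true)] `&` [set w | (X n w == 1) = true]) `|`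
  ([set w | Q (rcons (signs n w) false)] `&` [set w | (X n w == 1) = false])).
  apply: measurableU; apply: measurableI; try exact: measurable_sign.
    exact: (IH (fun s => Q (rcons s true))).
  exact: (IH (fun s => Q (rcons s false))).
apply/seteqP; split => w /=; rewrite /signs mkseqS.
  by case: (X n w == 1) => ?; [left|right].
by case=> -[] + ->.
Qed.

Lemma take_signs m n w : take m (signs (m + n) w) = signs m w.
Proof. by rewrite /signs /mkseq -map_take take_iota (minn_idPl (leq_addr _ _)). Qed.

(** The only place where independence is used. *)
Lemma prob_prefix (s : seq bool) :
  P [set w | signs (size s) w = s] = (2^-1 ^+ size s)%:E.
Proof.
pose J := [fset i in iota 0 (size s)]%fset.
pose A i : set R := if nth true s i then [set 1] else ~` [set 1].
have mA i : measurable (A i).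
  by rewrite /A; case: nth => //; apply: measurableC.
have PA i : P (X i @^-1` A i) = (2^-1)%:E.
  have P1 := (Xsign i).1; rewrite /A; case: nth => //.
  rewrite -preimage_setC probability_setC.
    by rewrite [P _]P1 -EFinB; congr EFin; field.
  exact: measurable_funPTI.
have -> : [set w | signs (size s) w = s] = \bigcap_(i in [set` J]) (X i @^-1` A i).
  apply/seteqP; split => w /= => [ws i|wA].
    rewrite /= !inE mem_iota /= add0n => is_.
    have := congr1 (fun t => nth true t i) ws.
    by rewrite nth_mkseq// /A /= => <-; case: eqP.
  apply: (@eq_from_nth _ true); first by rewrite size_mkseq.
  move=> i; rewrite size_mkseq => is_; rewrite nth_mkseq//.
  have := wA i; rewrite /= !inE mem_iota /= add0n => /(_ is_).
  by rewrite /A; case: nth => /= [->|/eqP/negbTE]; rewrite ?eqxx.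
rewrite Xindep// (eq_bigr (fun=> (2^-1)%:E)) => [|i _]; last exact: PA.
rewrite prodEFin big_const_seq count_predT iter_mulr_1.
by rewrite /J -/(#|` _|) card_fseq undup_id ?iota_uniq// size_iota.
Qed.

(** The signs of the walk are uniformly distributed over sign sequences.  The
induction conditions on longer and longer prefixes, starting from
[prob_prefix]. *)
Lemma prob_signs n (Q : seq bool -> bool) :
  P [set w | Q (signs n w)] = (mean n (fun s => (Q s)%:R))%:E.
Proof.
suff H (s : seq bool) : P [set w | signs (size s) w = s /\ Q (signs (size s + n) w)] =
    (2^-1 ^+ size s * mean n (fun t => (Q (s ++ t))%:R))%:E.
  have := H [::]; rewrite expr0 mul1r /= => <-; congr (P _).
  by apply/seteqP; split => w //= -[].
elim: n s => [|n IH] s.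
  rewrite /= cats0 addn0; have [q|q] := boolP (Q s).
    rewrite mulr1 -prob_prefix; congr (P _); apply/seteqP; split => w /= => [[]//|->].
    by split.
  rewrite mulr0 -[RHS](measure0 P); congr (P _); apply/seteqP; split => w //= -[->].
  by rewrite (negbTE q).
have rconsE b : [set w | signs (size s).+1 w = rcons s b /\ Q (signs (size s + n.+1) w)] =
   [set w | signs (size s) w = s /\ Q (signs (size s + n.+1) w)] `&`
   [set w | (X (size s) w == 1) = b].
  apply/seteqP; split => w /=; rewrite /signs mkseqS.
    by move=> [/eqP]; rewrite eqseq_rcons => /andP[/eqP -> /eqP ->].
  by move=> [[-> ?] ->].
have IHb b := IH (rcons s b).
have mb b : measurable [set w | signs (size s).+1 w = rcons s b /\ Q (signs (size s + n.+1) w)].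
  have := measurable_signs (size s + n.+1) (fun t => (take (size s).+1 t == rcons s b) && Q t).
  congr measurable; apply/seteqP; split => w /=; rewrite addnS -addSn take_signs.
    by move=> /andP[/eqP].
  by move=> [-> ->]; rewrite eqxx.
rewrite (_ : [set w | _] =
  [set w | signs (size s).+1 w = rcons s true /\ Q (signs (size s + n.+1) w)] `|`
  [set w | signs (size s).+1 w = rcons s false /\ Q (signs (size s + n.+1) w)]); last first.
  rewrite !rconsE -setIUr; apply/seteqP; split => w /= => [h|[]//].
  by split => //; case: eqP; [left|right].
have [hT hF] := (IHb true, IHb false); rewrite !size_rcons !addSnnS in hT hF.
transitivity (P [set w | signs (size s).+1 w = rcons s true /\ Q (signs (size s + n.+1) w)] +
  P [set w | signs (size s).+1 w = rcons s false /\ Q (signs (size s + n.+1) w)])%E.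
  apply: measureU => //; apply/seteqP; split => w //= -[[-> _] [/eqP]].
  by rewrite eqseq_rcons andbF.
rewrite hT hF -EFinD; congr EFin => /=.
under [X in _ = _ * ((_ + X) / _)]eq_mean do rewrite -cat_rcons.
under [X in _ = _ * ((X + _) / _)]eq_mean do rewrite -cat_rcons.
by rewrite exprSr; field.
Qed.

End Signs.
Arguments signs {d T R P}.

Lemma infinite_unbounded (A : set nat) :
  (forall n, exists2 m, (n <= m)%N & A m) -> infinite_set A.
Proof.
move=> unb /finite_seqP[s As]; have [m sm Am] := unb (\max_(i <- s) i).+1.
have ms : m \in s by move: Am; rewrite As.
by have := leq_bigmax_seq (F := id) m ms erefl; rewrite leqNgt sm.
Qed.

Section WalkOfSigns.
Context (d : measure_display) (T : measurableType d) (R : realType)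
  (P : probability T R) (X : nat -> {RV P >-> R}).
Hypothesis Xsign : forall i : nat, fair_sign (X i).
Local Open Scope classical_set_scope.

Lemma negligible_not_sign i : P.-negligible [set w | X i w != 1 /\ X i w != -1].
Proof.
have m1 (x : R) : measurable [set w | X i w = x].
  by rewrite (_ : [set w | _] = X i @^-1` [set x])//; exact: measurable_funPTI.
exists (~` ([set w | X i w = 1] `|` [set w | X i w = -1])); split.
- by apply: measurableC; apply: measurableU.
- rewrite probability_setC; last exact: measurableU.
  rewrite measureU//; last first.
    by apply/seteqP; split => w //= -[->] ?; lra.
  by rewrite /= (Xsign i).1 (Xsign i).2 -EFinD; congr EFin; field.
- by move=> w /= [/eqP ? /eqP ?] [].
Qed.

Lemma walk_position (a : nat -> nat) w n :
  (forall i, X i w = 1 \/ X i w = -1) ->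
  walk (fun n => (a n)%:R) X n w = (position a (signs X n w))%:~R.
Proof.
move=> Xw; rewrite /walk /position size_mkseq rmorph_sum; apply: eq_bigr => i _ /=.
rewrite nth_mkseq// rmorphM /=; congr (_ * _).
case: (Xw i) => ->; first by rewrite eqxx.
by rewrite lt_eqF /= ?rmorphN//; lra.
Qed.
End WalkOfSigns.

Theorem theorem5 (d : measure_display) (T : measurableType d) (R : realType)
    (P : probability T R) (X : nat -> {RV P >-> R})
    (Xindep : mutually_independent X)
    (Xsign : forall i : nat, fair_sign (X i))
    (L : nat -> nat) (Lpos : forall k : nat, (1 <= k)%N -> (0 < L k)%N)
    (eps r : R) (k0 : nat) (eps_gt0 : 0 < eps) (r_gt0 : 0 < r)
    (k0_ge2 : (2 <= k0)%N)
    (HL : forall k k' : nat, (k0 <= k)%N -> (k0 <= k')%N ->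
      k%:R / ln (k%:R : R) - 2 <= (k%:R : R) - k'%:R ->
      [/\ (((2 + eps) * ln (k%:R : R))%:E <=
            (L k)%:R%:E / (\sum_(1 <= j < k'.+1) L j)%:R%:E)%E,
          ((2 * r)%:E <=
            (L k)%:R%:E / (\sum_(k'.+1 <= j < k) L j)%:R%:E)%E
        & (k ^ 4 <= L k)%N]) :
  as_recurrent P (walk (fun n => (block_seq L n)%:R) X).
Proof.
have [M [K HM]] := growth_bound R L eps r k0 Lpos eps_gt0 r_gt0 k0_ge2 HL.
pose miss I m : set T := [set w | avoids_zero L I m (signs X (block_start L m.*2) w)]%classic.
pose never I : set T := (\bigcap_m miss I m)%classic.
have mmiss I m : d.-measurable%classic (miss I m) by exact: measurable_signs.
have small (I : nat) (delta : R) : 0 < delta ->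
    exists m, (P (miss I m) <= (2 * delta)%:E)%E.
  move=> delta0.
  have [c [c0 [K' step]]] := avoids_zero_step R L M K delta Lpos delta0 HM.
  have [||m _ em] := @harmonic_descent R
    (fun m => mean (block_start L m.*2) (fun s => (avoids_zero L I m s)%:R))
    c delta (I + K').+1 c0 delta0 => //.
    by move=> m Im; apply: step; lia.
  by exists m; rewrite prob_signs// lee_fin.
have never0 I : P.-negligible%classic (never I).
  exists (never I); split => //; first exact: bigcap_measurable.
  apply/eqP; rewrite eq_le measure_ge0 andbT; apply/lee_addgt0Pr => x x0.
  rewrite add0e; have [m] := small I (x / 2) (divr_gt0 x0 (ltr0Sn _ 1)).
  rewrite mulrC divfK//; apply: le_trans; apply: le_measure; rewrite ?inE//.
    exact: bigcap_measurable.
  by move=> w /(_ m); apply.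
apply: negligibleS (negligibleU (negligible_bigcup never0)
  (negligible_bigcup (negligible_not_sign _ _ _ _ X Xsign))) => w.
apply: contra_notP => /not_orP[nev sgn] /=.
have Xw i : X i w = 1 \/ X i w = -1.
  by apply: contrapT => /not_orP[/eqP x1 /eqP x2]; apply: sgn; exists i.
apply: infinite_unbounded => I.
have [m] : exists m, ~ miss I m w.
  by apply/not_existsP => all_miss; apply: nev; exists I => // m _; apply: contrapT.
move=> /negP; rewrite -has_predC => /hasP[j].
rewrite mem_index_iota => /andP[Ij jm] /=; rewrite negbK => /hasP[n].
rewrite mem_iota addnS ltnS => /andP[jn nj] /eqP pos0.
exists n.
  apply: leq_trans jn; apply: leq_trans Ij _.
  by apply: leq_trans (leq_block_start_id L Lpos _); lia.
rewrite /= walk_position//; move: pos0.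
have nm : (n <= block_start L m.*2)%N.
  by apply: leq_trans nj _; rewrite -block_startS//; apply: leq_block_start; lia.
by rewrite -(subnKC nm) take_signs => ->.
Qed.
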